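(* Let $d\ge 2$ and let $\gamma_d$ be the infimum of the set of all $\gamma\ge 0$ for which the equation $\exp(-\gamma(1-x)^d)=x$ has a solution $x<1$. Let $\delta>0$ and $0<c<\gamma_d$ be fixed and $p=\frac{c}{n}$. Then for $Y\in Y_d(n,p)$, $$\Pr\big[f_d(R_\infty(Y))>\delta n^d\big]=o(1)\quad (n\to\infty),$$ where $f_d(R_\infty(Y))$ is the number of $d$-simplices of $R_\infty(Y)$.
   Context: $\Delta_{n-1}$ denotes the $(n-1)$-simplex on vertex set $[n]$. $Y_d(n,p)$ is the probability space of complexes $\Delta_{n-1}^{(d-1)}\subset Y\subset\Delta_{n-1}^{(d)}$ in which each $d$-simplex is included independently with probability $p$. A $(d-1)$-simplex is a free face of $Y$ if it lies in exactly one $d$-simplex of $Y$; $R(Y)$ is obtained from $Y$ by removing all free $(d-1)$-faces together with the $d$-simplices containing them; $R_0(Y)=Y$, $R_i(Y)=R(R_{i-1}(Y))$, and $R_\infty(Y)$ is the eventual stable complex (obtained after performing all possible such collapse steps). *)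

(* Defs.v *)
From HB Require Import structures.
From mathcomp Require Import all_boot all_order all_algebra.
From mathcomp Require Import all_classical all_reals all_analysis.
Set Implicit Arguments. Unset Strict Implicit. Unset Printing Implicit Defensive.
Import Order.TTheory GRing.Theory Num.Theory.
Local Open Scope ring_scope.

(* Vertex set [n] is 'I_n; a simplex is a finite set of vertices.
   A complex Delta^{(d-1)} ⊂ Y ⊂ Delta^{(d)} is determined by its set of
   d-simplices, i.e. a set S of (d+1)-subsets of 'I_n. *)
Definition dsimplices (n d : nat) : {set {set 'I_n}} := [set s : {set 'I_n} | #|s| == d.+1]%SET.

Definition free_face (n d : nat) (S : {set {set 'I_n}}) (t : {set 'I_n}) : bool :=
  (#|t| == d) && (#|[set s in S | t \subset s]%SET| == 1%N).

(* R(Y): remove all free (d-1)-faces and the d-simplices containing them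
   (tracked on the d-simplices). *)
Definition collapse_step (n d : nat) (S : {set {set 'I_n}}) : {set {set 'I_n}} :=
  ([set s in S | ~~ [exists t : {set 'I_n}, free_face d S t && (t \subset s)]])%SET.

Definition R_iter (n d i : nat) (S : {set {set 'I_n}}) : {set {set 'I_n}} :=
  iter i (collapse_step d) S.

(* R_infty(Y): the stable complex; each non-stationary step removes at least
   one d-simplex, so the process is stable after #|S| steps. *)
Definition R_infty (n d : nat) (S : {set {set 'I_n}}) : {set {set 'I_n}} :=
  R_iter d #|S| S.

Definition prob_Yd (R : realType) (n d : nat) (p : R)
    (E : pred {set {set 'I_n}}) : R :=
  \sum_(S : {set {set 'I_n}} | (S \subset dsimplices n d) && E S)
     p ^+ #|S| * (1 - p) ^+ (#|dsimplices n d| - #|S|).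

Definition gamma_d (R : realType) (d : nat) : R :=
  inf [set g : R | 0 <= g /\ exists x : R, x < 1 /\ expR (- (g * (1 - x) ^+ d)) = x].

(* Main.v *)
(** A d-simplex of R_infty(Y) survives k rounds of collapses for every k, so each
    of its facets must be the root of a depth-k non-backtracking exploration tree in
    Y in which every facet has a further simplex all of whose other facets survive.
    Let s_k bound the probability of such a survival event.  Outside an event of
    probability O(1/n^2) (few vertices spanning too many simplices of Y) the
    explorations from the facets of a given simplex use disjoint sets of simplices,
    so the van den Berg-Kesten inequality bounds by p s_k^d + O(1/n^2) the
    probability that the simplex is present and d of its facets survive; Harris'
    inequality, over the at most n simplices through a facet, then gives
    s_(k+1) <= 1 - (1 - p s_k^d - O(1/n^2))^n.  For c < g < gamma_d this yields
    s_k <= u_k for large n, where u_0 = 1 and u_(k+1) = 1 - exp(- g u_k^d).  The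
    limit L of u_k satisfies exp(- g L^d) = 1 - L, hence L = 0 as g < gamma_d, and
    Markov's inequality for the number of surviving simplices concludes. *)

Require Import Defs.
From HB Require Import structures.
From mathcomp Require Import all_boot all_order all_algebra.
From mathcomp Require Import ring lra.
Import Order.TTheory GRing.Theory Num.Theory.
Local Open Scope ring_scope.

(** * Product measure on subsets: Harris and van den Berg-Kesten inequalities *)

(** The sum defining [prob_Yd], over an arbitrary ground set so that one can induct on [D]; at
    [D = dsimplices n d] the two are convertible. *)
Definition pr {R : realFieldType} {T : finType} (p : R) (D : {set T})
    (E : pred {set T}) : R :=
  \sum_(S : {set T} | (S \subset D) && E S)
     p ^+ #|S| * (1 - p) ^+ (#|D| - #|S|).

Definition increasing {T : finType} (E : pred {set T}) :=
  forall A B : {set T}, A \subset B -> E A -> E B.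

Lemma setU1_ind (T : finType) (P : {set T} -> Prop) :
  P set0 -> (forall (x : T) (D : {set T}), x \notin D -> P D -> P (x |: D)) -> forall D, P D.
Proof.
move=> P0 PU D; elim: {D}#|D| {-2}D (erefl #|D|) => [|m IH] D cD.
  by rewrite (cards0_eq cD).
have /card_gt0P[x xD] : (0 < #|D|)%N by rewrite cD.
rewrite -(setD1K xD); apply: PU; first by rewrite !inE eqxx.
by apply: IH; move: cD; rewrite (cardsD1 x) xD => -[].
Qed.

Lemma pr_eq {R : realFieldType} {T : finType} (p : R) (D : {set T})
    (E F : pred {set T}) :
  (forall S : {set T}, S \subset D -> E S = F S) -> pr p D E = pr p D F.
Proof. by move=> EF; apply: eq_bigl => S; case: (boolP (S \subset D)) => // /EF ->. Qed.

Lemma pr_set0 {R : realFieldType} {T : finType} (p : R) (E : pred {set T}) :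
  pr p set0 E = (E set0)%:R.
Proof.
rewrite /pr (eq_bigl (fun S : {set T} => (S == set0) && E S)); last by move=> S; rewrite subset0.
case: (boolP (E set0)) => E0.
  rewrite (big_pred1 set0) ?cards0 ?mulr1 // => S /=.
  by case: eqP => [->|].
by apply: big_pred0 => S; case: eqP => [->|//]; apply: negbTE.
Qed.

(** Conditioning on whether [x] is chosen: the inductive step of the inequalities below. *)
Lemma pr_setU1 {R : realFieldType} {T : finType} (p : R) (D : {set T}) (x : T)
    (E : pred {set T}) : x \notin D ->
  pr p (x |: D) E = p * pr p D (fun S => E (x |: S)) + (1 - p) * pr p D E.
Proof.
move=> xD; rewrite /pr (bigID (fun S : {set T} => x \in S)) /=; congr (_ + _).
  rewrite big_distrr /= (reindex_onto (fun S => x |: S) (fun S => S :\ x)) /=; last first.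
    by move=> S /andP[_ xS]; rewrite setD1K.
  have cond (S : {set T}) : [&& x |: S \subset x |: D, E (x |: S) & x \in x |: S]
      && ((x |: S) :\ x == S) = (S \subset D) && E (x |: S).
    rewrite setU11 andbT; have [xS|xS] := boolP (x \in S).
      have -> : (S \subset D) = false.
        by apply/negbTE; apply: contra xD => /subsetP /(_ _ xS).
      by apply/negbTE/negP => /andP[_ /eqP /setP /(_ x)]; rewrite !inE eqxx xS.
    rewrite setU1K // eqxx andbT; congr andb.
    by rewrite -[D in RHS](setU1K xD) subsetD1 xS andbT subUset sub1set setU11.
  rewrite (eq_bigl (fun S : {set T} => (S \subset D) && E (x |: S))); last first.
    by move=> S; rewrite -cond -!andbA.
  apply: eq_bigr => S /andP[SD _].
  have xS : x \notin S by apply: contra xD => /(subsetP SD).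
  by rewrite !cardsU1 xS xD /= !add1n subSS exprS mulrA.
rewrite big_distrr /=; apply: eq_big => [S|S /andP[/andP[SD _] xS]].
  rewrite andbAC; congr andb.
  by rewrite -[D in RHS](setU1K xD) subsetD1.
have {}SD : S \subset D by rewrite -(setU1K xD) subsetD1 SD.
by rewrite cardsU1 xD add1n subSn ?subset_leq_card // exprS mulrCA.
Qed.

Lemma prT {R : realFieldType} {T : finType} (p : R) (D : {set T}) :
  pr p D predT = 1.
Proof.
elim/setU1_ind: D => [|x D xD IH]; first by rewrite pr_set0.
by rewrite pr_setU1 // IH; ring.
Qed.


Lemma prU {R : realFieldType} {T : finType} (p : R) (D : {set T})
    (A B : pred {set T}) :
  pr p D (predU A B) + pr p D (predI A B) = pr p D A + pr p D B.
Proof.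
rewrite /pr !big_mkcondr -!big_split /=; apply: eq_bigr => S _.
by case: (A S); case: (B S); rewrite /= ?addr0 ?add0r.
Qed.

Lemma prC {R : realFieldType} {T : finType} (p : R) (D : {set T})
    (E : pred {set T}) : pr p D (predC E) = 1 - pr p D E.
Proof.
rewrite -(prT p D) /pr !big_mkcondr -sumrB.
by apply: eq_bigr => S _ /=; case: (E S); rewrite ?subrr ?subr0.
Qed.

Lemma pr_ge0 {R : realFieldType} {T : finType} (p : R) (D : {set T})
    (E : pred {set T}) : 0 <= p <= 1 -> 0 <= pr p D E.
Proof.
move=> /andP[p0 p1]; apply: sumr_ge0 => S _.
by rewrite mulr_ge0 ?exprn_ge0 ?subr_ge0.
Qed.

Lemma pr_mono {R : realFieldType} {T : finType} (p : R) (D : {set T})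
    (E F : pred {set T}) : 0 <= p <= 1 ->
  (forall S : {set T}, S \subset D -> E S -> F S) -> pr p D E <= pr p D F.
Proof.
move=> /andP[p0 p1] EF; rewrite /pr !big_mkcondr.
apply: ler_sum => S SD; case: ifP => [/(EF _ SD) -> //|_].
by case: ifP => // _; rewrite mulr_ge0 ?exprn_ge0 ?subr_ge0.
Qed.

Lemma pr_le1 {R : realFieldType} {T : finType} (p : R) (D : {set T})
    (E : pred {set T}) : 0 <= p <= 1 -> pr p D E <= 1.
Proof. by move=> hp; rewrite -(prT p D); apply: pr_mono. Qed.

Lemma pr_union_bound {R : realFieldType} {T I : finType} (p : R) (D : {set T})
    (P : pred I) (A : I -> pred {set T}) (E : pred {set T}) : 0 <= p <= 1 ->
  (forall S : {set T}, S \subset D -> E S -> exists2 i, P i & A i S) ->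
  pr p D E <= \sum_(i | P i) pr p D (A i).
Proof.
move=> hp EA; have [p0 p1] := andP hp.
rewrite /pr !big_mkcondr.
under [leRHS]eq_bigr => i _ do rewrite big_mkcondr.
rewrite exchange_big; apply: ler_sum => S SD.
have w0 : 0 <= p ^+ #|S| * (1 - p) ^+ (#|D| - #|S|).
  by rewrite mulr_ge0 ?exprn_ge0 ?subr_ge0.
have s0 (Q : pred I) : 0 <= \sum_(i | Q i)
    (if A i S then p ^+ #|S| * (1 - p) ^+ (#|D| - #|S|) else 0).
  by apply: sumr_ge0 => i _; case: ifP.
case: ifP => // /(EA _ SD)[i Pi Ai].
by rewrite (bigD1 i) //= Ai lerDl s0.
Qed.

Lemma pr_markov {R : realFieldType} {T : finType} (p : R) (D : {set T})
    (f : {set T} -> {set T}) (a : R) : 0 <= p <= 1 -> 0 < a ->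
  (forall S : {set T}, S \subset D -> f S \subset D) ->
  pr p D (fun S => a < #|f S|%:R) <= (\sum_(x in D) pr p D (fun S : {set T} => x \in f S)) / a.
Proof.
move=> hp a0 fD; have [p0 p1] := andP hp.
rewrite ler_pdivlMr //.
rewrite /pr !big_mkcondr.
under [leRHS]eq_bigr => i _ do rewrite big_mkcondr.
rewrite exchange_big big_distrl; apply: ler_sum => S SD.
have w0 : 0 <= p ^+ #|S| * (1 - p) ^+ (#|D| - #|S|).
  by rewrite mulr_ge0 ?exprn_ge0 ?subr_ge0.
rewrite -big_mkcondr (eq_bigl (mem (f S))) => [|x]; last first.
  by rewrite /= andb_idl // => /(subsetP (fD _ SD)).
rewrite sumr_const -[leRHS]mulr_natr /=.
case: ifP => [af|_]; last by rewrite mul0r mulr_ge0.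
by rewrite ler_wpM2l // ltW.
Qed.

(** Only an upper bound, since [F] may stick out of [D], in which case the probability is 0. *)
Lemma pr_superset {R : realFieldType} {T : finType} (p : R) (D F : {set T}) :
  0 <= p <= 1 -> pr p D (fun S : {set T} => F \subset S) <= p ^+ #|F|.
Proof.
move=> hp; have [p0 p1] := andP hp.
elim/setU1_ind: D F => [|x D xD IH] F.
  rewrite pr_set0 subset0; case: eqP => [->|_]; first by rewrite cards0.
  by rewrite exprn_ge0.
rewrite pr_setU1 // (@pr_eq _ _ _ _ (fun S : {set T} => F \subset x |: S)
  (fun S : {set T} => F :\ x \subset S)); last first.
  by move=> S _; rewrite subDset.
case: (boolP (x \in F)) => xF.
  rewrite (@pr_eq _ _ _ _ (fun S : {set T} => F \subset S) pred0); last first.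
    move=> S SD; apply/negbTE; apply: contra xD => FS.
    by apply: (subsetP SD); apply: (subsetP FS).
  rewrite [pr _ _ pred0]big_pred0; last by move=> S; rewrite andbF.
  by rewrite mulr0 addr0 (cardsD1 x F) xF exprS ler_wpM2l.
have -> : F :\ x = F by apply/setDidPl; rewrite disjoint_sym disjoints1.
by rewrite -mulrDl addrC subrK mul1r.
Qed.

Lemma harris {R : realFieldType} {T : finType} (p : R) (D : {set T})
    (A B : pred {set T}) : 0 <= p <= 1 ->
  increasing A -> increasing B ->
  pr p D (predC A) * pr p D (predC B) <= pr p D (predI (predC A) (predC B)).
Proof.
move=> hp; have [p0 p1] := andP hp.
elim/setU1_ind: D A B => [|x D xD IH] A B iA iB.
  by rewrite !pr_set0 -natrM mulnb.
have shift E : increasing E -> increasing (fun S => E (x |: S)).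
  by move=> iE S S' SS'; apply: iE; apply: setUS.
have sub E : increasing E -> pr p D (predC (fun S => E (x |: S))) <= pr p D (predC E).
  by move=> iE; apply: pr_mono => // S _ /=; apply: contra; apply: iE; apply: subsetUr.
have p1' : 0 <= 1 - p by rewrite subr_ge0.
(* Chebyshev's inequality for one coordinate: both factors drop when [x] is added, so the average of
   the products exceeds the product of the averages by [p * (1 - p) * ((a - a1) * (b - b1))]. *)
have key (a1 b1 a b ab1 ab : R) : a1 <= a -> b1 <= b -> a1 * b1 <= ab1 -> a * b <= ab ->
    (p * a1 + (1 - p) * a) * (p * b1 + (1 - p) * b) <= p * ab1 + (1 - p) * ab.
  move=> ha hb h1 h0.
  have h2 : 0 <= p * (1 - p) * ((a - a1) * (b - b1)).
    by rewrite !mulr_ge0 ?subr_ge0.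
  have h3 := ler_wpM2l p0 h1; have h4 := ler_wpM2l p1' h0; lra.
rewrite !pr_setU1 //; apply: key; [exact: sub|exact: sub| |exact: IH].
exact: IH (shift _ iA) (shift _ iB).
Qed.

Lemma harris_seq {R : realFieldType} {T : finType} {I : eqType} (p : R) (D : {set T})
    (s : seq I) (A : I -> pred {set T}) : 0 <= p <= 1 ->
  (forall i, increasing (A i)) ->
  \prod_(i <- s) (1 - pr p D (A i)) <= 1 - pr p D (fun S => has (fun i => A i S) s).
Proof.
move=> hp iA; elim: s => [|i s IH].
  rewrite big_nil /pr big_pred0 ?subr0 // => S; by rewrite andbF.
rewrite big_cons -!prC.
have iH : increasing (fun S => has (fun i => A i S) s).
  by move=> S S' SS' /hasP[j js Aj]; apply/hasP; exists j => //; apply: iA Aj.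
apply: (le_trans _ (le_trans (harris p D _ _ hp (iA i) iH) _)).
  by rewrite ler_wpM2l ?pr_ge0 // prC.
by apply: pr_mono => // S _ /=; rewrite negb_or.
Qed.

(* Disjoint occurrence; for increasing [B] the largest set disjoint from the
   witness of [A] serves as the witness of [B]. *)
Definition docc {T : finType} (A B : pred {set T}) : pred {set T} :=
  fun S => [exists S1 : {set T}, [&& S1 \subset S, A S1 & B (S :\: S1)]].

Lemma docc_increasing {T : finType} (A B : pred {set T}) :
  increasing B -> increasing (docc A B).
Proof.
move=> iB S S' SS' /existsP[S1 /and3P[S1S A1 B1]]; apply/existsP; exists S1.
by rewrite (subset_trans S1S SS') A1 /=; apply: iB B1; apply: setSD.
Qed.

Lemma docc_sub {T : finType} (A A' B B' : pred {set T}) (S : {set T}) :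
  subpred A A' -> subpred B B' -> docc A B S -> docc A' B' S.
Proof.
move=> AA BB /existsP[S1 /and3P[S1S A1 B1]]; apply/existsP; exists S1.
by rewrite S1S AA // BB.
Qed.

(** The two witnesses are disjoint, so at most one of them uses [x]; the other event already occurs
    without it. *)
Lemma docc_setU1 {T : finType} (A B : pred {set T}) (x : T) (S : {set T}) :
  x \notin S -> docc A B (x |: S) ->
  docc (fun S => A (x |: S)) B S || docc A (fun S => B (x |: S)) S.
Proof.
move=> xS /existsP[S1 /and3P[S1S A1 B1]]; case: (boolP (x \in S1)) => xS1.
  apply/orP; left; apply/existsP; exists (S1 :\ x).
  rewrite setD1K // A1 /= subDset S1S /=.
  suff <- : (x |: S) :\: S1 = S :\: (S1 :\ x) by [].
  by apply/setP => y; rewrite !inE; case: eqP => [->|]; rewrite ?xS1 ?(negbTE xS).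
apply/orP; right; apply/existsP; exists S1; rewrite A1.
have -> : S1 \subset S.
  apply/subsetP => y yS1; move: (subsetP S1S _ yS1); rewrite !inE.
  by case: eqP => // yx; rewrite yx (negbTE xS1) in yS1.
suff <- : (x |: S) :\: S1 = x |: (S :\: S1) by [].
by apply/setP => y; rewrite !inE; case: eqP => [->|]; rewrite ?xS1.
Qed.

(* The van den Berg-Kesten inequality.  For [p <= 1/2] the one-coordinate
   induction closes without the usual duplication argument. *)
Lemma bk {R : realFieldType} {T : finType} (p : R) (D : {set T})
    (A B : pred {set T}) : 0 <= p -> p <= 2^-1 ->
  increasing A -> increasing B ->
  pr p D (docc A B) <= pr p D A * pr p D B.
Proof.
move=> p0 p2; have hp : 0 <= p <= 1 by rewrite p0 /=; lra.
elim/setU1_ind: D A B => [|x D xD IH] A B iA iB.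
  rewrite !pr_set0 -natrM mulnb ler_nat.
  case: (boolP (docc _ _ _)) => // /existsP[S1 /and3P[]].
  by rewrite subset0 => /eqP-> -> /=; rewrite setD0 => ->.
pose A1 S := A (x |: S); pose B1 S := B (x |: S).
have iA1 : increasing A1 by move=> S S' SS'; apply: iA; apply: setUS.
have iB1 : increasing B1 by move=> S S' SS'; apply: iB; apply: setUS.
have AA1 : subpred A A1 by move=> S; apply: iA; apply: subsetUr.
have BB1 : subpred B B1 by move=> S; apply: iB; apply: subsetUr.
have h1 : pr p D (fun S => docc A B (x |: S)) <= pr p D (predU (docc A1 B) (docc A B1)).
  apply: pr_mono => // S SD; apply: docc_setU1.
  by apply: contra xD; apply: (subsetP SD).
(* The event without [x] lies in both alternatives, so inclusion-exclusion allows subtracting its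
   probability from the bound for the union. *)
have h2 : pr p D (docc A B) <= pr p D (predI (docc A1 B) (docc A B1)).
  by apply: pr_mono => // S SD AB /=; apply/andP; split; apply: docc_sub AB.
have h3 := prU p D (docc A1 B) (docc A B1).
have h4 := IH _ _ iA1 iB; have h5 := IH _ _ iA iB1; have h6 := IH _ _ iA iB.
have h7 : pr p D A <= pr p D A1 by apply: pr_mono => // S _; apply: AA1.
have h8 : pr p D B <= pr p D B1 by apply: pr_mono => // S _; apply: BB1.
(* The left side is at most [p * (a1 * b + a * b1) + (1 - 2 * p) * x3]. Replacing [x3] by [a * b]
   uses [p <= 1/2], and the right side exceeds the result by exactly
   [p ^+ 2 * ((a1 - a) * (b1 - b))]. *)
have key (x1 x2 x3 x4 y1 y2 a b a1 b1 : R) : x1 <= x2 -> x3 <= x4 -> x2 + x4 = y1 + y2 ->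
    y1 <= a1 * b -> y2 <= a * b1 -> x3 <= a * b -> a <= a1 -> b <= b1 ->
    p * x1 + (1 - p) * x3 <= (p * a1 + (1 - p) * a) * (p * b1 + (1 - p) * b).
  move=> {}h1 {}h2 {}h3 {}h4 {}h5 {}h6 {}h7 {}h8.
  have h9 : 0 <= p ^+ 2 * ((a1 - a) * (b1 - b)) by rewrite !mulr_ge0 ?subr_ge0 ?exprn_ge0.
  have h10 : p * x1 <= p * (a1 * b + a * b1 - x3) by apply: ler_wpM2l => //; lra.
  have h11 : (1 - 2 * p) * x3 <= (1 - 2 * p) * (a * b) by apply: ler_wpM2l => //; lra.
  lra.
by rewrite !pr_setU1 //; apply: key h1 h2 h3 h4 h5 h6 h7 h8.
Qed.

Definition docc_seq {T : finType} {I : Type} (s : seq I) (A : I -> pred {set T}) :=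
  foldr (fun i B => docc (A i) B) predT s.

Lemma docc_seq_increasing {T : finType} {I : Type} (s : seq I) (A : I -> pred {set T}) :
  increasing (docc_seq s A).
Proof. by elim: s => [|i s IH] //=; apply: docc_increasing. Qed.

Lemma bk_seq {R : realFieldType} {T : finType} {I : Type} (p : R) (D : {set T})
    (s : seq I) (A : I -> pred {set T}) : 0 <= p -> p <= 2^-1 ->
  (forall i, increasing (A i)) ->
  pr p D (docc_seq s A) <= \prod_(i <- s) pr p D (A i).
Proof.
move=> p0 p2 iA; have hp : 0 <= p <= 1 by rewrite p0 /=; lra.
elim: s => [|i s IH]; first by rewrite big_nil prT.
rewrite big_cons; apply: le_trans (bk p D _ _ p0 p2 (iA i) _) _.
  exact: docc_seq_increasing.
by rewrite ler_wpM2l // pr_ge0.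
Qed.

Lemma docc_seqI {T : finType} {I : eqType} (s : seq I) (A : I -> pred {set T})
    (W : I -> {set T}) (S : {set T}) : uniq s ->
  (forall i, i \in s -> W i \subset S) ->
  (forall i, i \in s -> A i (W i)) ->
  {in s &, forall i j, i != j -> [disjoint W i & W j]} ->
  docc_seq s A S.
Proof.
elim: s S => [|i s IH] S //= /andP[is_ us] WS AW dW.
apply/existsP; exists (W i); rewrite WS ?AW ?inE ?eqxx //=.
apply: IH => // [j js|j js|j k js ks].
- rewrite subsetD WS ?inE ?js ?orbT // dW ?inE ?eqxx ?js ?orbT //.
  by apply: contraNneq is_ => <-.
- by apply: AW; rewrite inE js orbT.
- by apply: dW; rewrite inE ?js ?ks orbT.
Qed.

(** * Exploration and collapse *)

(* The facet [t] of the simplex [w |: t] survives [k] rounds, ignoring [w |: t]. *)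
Fixpoint surv {V : finType} (k : nat) (t : {set V}) (w : V) (Y : {set {set V}}) : bool :=
  if k is k'.+1 then
    [exists v, [&& v \notin t, v != w, v |: t \in Y &
       [forall (u | u \in t), surv k' ((v |: t) :\ u) u Y]]]
  else true.

(* All simplices inspected when deciding [surv]. *)
Fixpoint reach {V : finType} (k : nat) (t : {set V}) (w : V) (Y : {set {set V}}) :
    {set {set V}} :=
  if k is k'.+1 then
    \bigcup_(v | [&& v \notin t, v != w & v |: t \in Y])
      ((v |: t) |: \bigcup_(u in t) reach k' ((v |: t) :\ u) u Y)
  else set0.

(** A positive answer is certified by the inspected simplices alone, so [reach] can serve as the
    witness in a disjoint occurrence. *)
Lemma surv_reach {V : finType} (k : nat) (t : {set V}) (w : V) (Y Z : {set {set V}}) :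
  reach k t w Y \subset Z -> surv k t w Y -> surv k t w Z.
Proof.
elim: k t w => [//|k IH] t w /= /bigcupsP sub /existsP[v /and4P[vt vw vY /forall_inP sv]].
have := sub v; rewrite vt vw vY => /(_ isT); rewrite subUset sub1set => /andP[vZ /bigcupsP rZ].
apply/existsP; exists v; rewrite vt vw vZ /=; apply/forall_inP => u ut.
by apply: IH (sv _ ut); apply: rZ.
Qed.

Lemma reach_sub {V : finType} (k : nat) (t : {set V}) (w : V) (Y : {set {set V}}) :
  reach k t w Y \subset Y.
Proof.
elim: k t w => [|k IH] t w /=; first exact: sub0set.
apply/bigcupsP => v /and3P[_ _ vY]; rewrite subUset sub1set vY /=.
by apply/bigcupsP => u _; apply: IH.
Qed.

Lemma surv_increasing {V : finType} (k : nat) (t : {set V}) (w : V) :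
  increasing (surv k t w).
Proof. by move=> Y Z YZ; apply: surv_reach; apply: subset_trans YZ; apply: reach_sub. Qed.

(** * Bad configurations and disjointness of explorations *)

Definition spanned {V : finType} (Y : {set {set V}}) (H : {set V}) : {set {set V}} :=
  [set e in Y | e \subset H].

(** A tree-like exploration from [s] has one simplex per new vertex besides [s], hence [j.+1] in
    all. One simplex more is already an excess, of expected number about [n ^ j * p ^ (j + 2)],
    which is of order [1/n^2] for [p = c/n]. *)
Definition bad {V : finType} (J : nat) (s : {set V}) (Y : {set {set V}}) : bool :=
  [exists j : 'I_J, [exists X : {set V},
     (#|X| == j :> nat) && (j.+2 <= #|spanned Y (s :|: X)|)%N]].

Lemma spanned_le {V : finType} (J : nat) (s H : {set V}) (Y : {set {set V}}) (m : nat) :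
  ~~ bad J s Y -> s \subset H -> #|H| = (#|s| + m)%N -> (m < J)%N ->
  (#|spanned Y H| <= m.+1)%N.
Proof.
move=> nb sH cH mJ; rewrite leqNgt; apply: contra nb => big.
apply/existsP; exists (Ordinal mJ); apply/existsP; exists (H :\: s).
have -> : s :|: (H :\: s) = H.
  by apply/setP => x; rewrite !inE; case: (boolP (x \in s)) => //= /(subsetP sH).
rewrite big andbT.
by rewrite cardsD (setIidPr sH) cH addKn.
Qed.

(* Without a bad configuration, every step of a non-backtracking exploration
   uses a fresh vertex, and the fresh vertex lies in a single new simplex. *)
Lemma walk {V : finType} (J : nat) (s : {set V}) (Y : {set {set V}}) :
  ~~ bad J s Y -> forall (k m : nat) (H t : {set V}) (w : V) (e : {set V}),
  s \subset H -> #|H| = (#|s| + m)%N -> (m + k < J)%N -> (m < #|spanned Y H|)%N ->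
  t \subset H -> (forall f, f \in spanned Y H -> t \subset f -> f = w |: t) ->
  e \in reach k t w Y ->
  exists (H' : {set V}) (m' : nat), [/\ H \subset H', #|H'| = (#|s| + m')%N & (m' <= m + k)%N] /\
    [/\ (m' < #|spanned Y H'|)%N, e \in spanned Y H', e \notin spanned Y H &
    forall f, f \in spanned Y H' -> f \in spanned Y H \/ f \subset t :|: (H' :\: H)].
Proof.
move=> nb; elim=> [|k IH] m H t w e sH cH mJ tight tH tf /=; first by rewrite inE.
case/bigcupP => v /and3P[vt vw vY] er.
(* If [v] were old, [v |: t] would be a spanned simplex through [t], hence equal to [w |: t],
   against [v != w]. *)
have vH : v \notin H.
  apply/negP => vH; have /tf : v |: t \in spanned Y H.
    by rewrite inE vY subUset sub1set vH.
  by move=> /(_ (subsetUr _ _)) /setP /(_ v); rewrite !inE eqxx (negbTE vw) (negbTE vt).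
have sH' : s \subset v |: H by apply: subset_trans sH (subsetUr _ _).
have cH' : #|v |: H| = (#|s| + m.+1)%N by rewrite cardsU1 vH cH addnS.
have vn : v |: t \notin spanned Y H.
  by rewrite inE negb_and subUset sub1set (negbTE vH) orbT.
have sub : (v |: t) |: spanned Y H \subset spanned Y (v |: H).
  rewrite subUset sub1set inE vY setUS //=; apply/subsetP => f; rewrite !inE => /andP[-> fH] /=.
  exact: subset_trans fH (subsetUr _ _).
have le1 : (#|spanned Y (v |: H)| <= m.+2)%N.
  by apply: spanned_le nb sH' cH' _; apply: leq_ltn_trans mJ; rewrite addnS ltnS leq_addr.
(* [H] already spans [m.+1] simplices and [v |: H] spans at most [m.+2], which leaves room for
   [v |: t] only. *)
have eqS : spanned Y (v |: H) = (v |: t) |: spanned Y H.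
  apply/esym/eqP; rewrite eqEcard sub cardsU1 vn add1n; exact: leq_trans le1 _.
have tight' : (m.+1 < #|spanned Y (v |: H)|)%N by rewrite eqS cardsU1 vn add1n ltnS.
case/setU1P: er => [->|/bigcupP[u ut er]].
  exists (v |: H), m.+1; split; first by split=> //; [exact: subsetUr|rewrite addnS ltnS leq_addr].
  split=> //; first by rewrite eqS setU11.
  move=> f; rewrite eqS => /setU1P[->|fH]; [right|by left].
  rewrite subUset subsetUl andbT sub1set !inE vH eqxx; by rewrite orbT.
have uv : u != v by apply: contraNneq vt => <-.
have uK : u |: ((v |: t) :\ u) = v |: t by rewrite setD1K // inE ut orbT.
have [|||H' [m' [[HH' cH'' m'k] [tightH' eH' eH fH']]]] :=
  IH m.+1 (v |: H) ((v |: t) :\ u) u e sH' cH' _ tight' _ _ er.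
- by rewrite addSnnS.
- by apply: subset_trans (subsetDl _ _) _; apply: setUS.
(* The next facet contains the fresh vertex [v], which lies in no simplex spanned by [H]. *)
- move=> f; rewrite eqS uK => /setU1P[-> //|fH] /subsetP /(_ v).
  rewrite !inE eq_sym uv eqxx => /(_ isT) vf.
  by move: fH; rewrite inE => /andP[_ /subsetP /(_ _ vf)]; rewrite (negbTE vH).
exists H', m'; split; first by split=> //; [exact: subset_trans (subsetUr _ _) HH'|rewrite addnS -addSn].
split=> //; first by apply: contra eH => eH; rewrite eqS inE eH orbT.
have vH' : v \in H' by apply: (subsetP HH'); rewrite setU11.
move=> f /fH'[|fs].
  rewrite eqS => /setU1P[->|fH]; [right|by left].
  by rewrite subUset subsetUl andbT sub1set !inE vH vH' orbT.
right; apply: subset_trans fs _; apply/subsetP => x; rewrite !inE.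
case/orP => [/andP[_ /orP[/eqP->|->//]]|/andP[/norP[_ ->] ->]]; last by rewrite orbT.
by rewrite vH vH' orbT.
Qed.

(** [walk] started from [H = s] and [m = 0]. The last clause is what allows a second walk to start
    from another facet of [s] inside the same [H]. *)
Lemma walk_from_root {V : finType} (k J : nat) (s : {set V}) (Y : {set {set V}}) (u : V)
    (e : {set V}) :
  (forall e, e \in Y -> #|e| = #|s|) -> s \in Y -> ~~ bad J s Y -> (k < J)%N ->
  u \in s -> e \in reach k (s :\ u) u Y ->
  exists (H : {set V}) (m : nat), [/\ s \subset H, #|H| = (#|s| + m)%N & (m <= k)%N] /\
    [/\ (m < #|spanned Y H|)%N, e \in spanned Y H, e != s &
    forall f, f \in spanned Y H -> f = s \/ u \notin f].
Proof.
move=> cY sY nb kJ us er.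
have spS f : f \in spanned Y s -> f = s.
  by rewrite inE => /andP[/cY cf fs]; apply/eqP; rewrite eqEcard fs cf leqnn.
have ss : s \in spanned Y s by rewrite inE sY subxx.
have [||||||H [m [[sH cH mk] [tight eH es fH]]]] := walk J s Y nb k 0 s (s :\ u) u e _ _ _ _ _ _ er.
- exact: subxx.
- by rewrite addn0.
- by [].
- by rewrite card_gt0; apply/set0Pn; exists s.
- exact: subsetDl.
- by move=> f /spS -> _; rewrite setD1K.
exists H, m; split=> //; split=> //; first by apply: contraNneq es => ->.
move=> f /fH[/spS ->|fs]; [by left|right].
by apply/negP => /(subsetP fs); rewrite !inE eqxx us.
Qed.

(** The walk towards a common [e] from [u] yields an [H] spanning [e]. A walk from [u'] continued
    from this [H] reaches only simplices that [H] does not span, a contradiction. Two walks of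
    length [k] are concatenated, whence [k.*2 < J]. *)
Lemma reach_disjoint {V : finType} (k J : nat) (s : {set V}) (Y : {set {set V}}) (u u' : V) :
  (forall e, e \in Y -> #|e| = #|s|) -> s \in Y -> ~~ bad J s Y -> (k.*2 < J)%N ->
  u \in s -> u' \in s -> u != u' ->
  [disjoint reach k (s :\ u) u Y & reach k (s :\ u') u' Y].
Proof.
move=> cY sY nb kJ us us' uu'; apply/pred0P => e /=; apply/negbTE/negP => /andP[er er'].
have kJ' : (k < J)%N by apply: leq_ltn_trans kJ; rewrite -addnn leq_addl.
have [H [m [[sH cH mk] [tight eH _ fH]]]] := walk_from_root k J s Y u e cY sY nb kJ' us er.
have [|||H' [m' [_ [_ _ /negP eH' _]]]] := walk J s Y nb k m H (s :\ u') u' e sH cH _ tight _ _ er'.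
- by apply: leq_ltn_trans kJ; rewrite -addnn leq_add2r.
- exact: subset_trans (subsetDl _ _) sH.
- move=> f /fH[-> _|uf /subsetP /(_ u)]; first by rewrite setD1K.
  by rewrite !inE uu' us (negbTE uf) => /(_ isT).
by [].
Qed.

Lemma surv_docc {V : finType} (k J : nat) (s U : {set V}) (Y : {set {set V}}) :
  (forall e, e \in Y -> #|e| = #|s|) -> (k.*2 < J)%N -> U \subset s ->
  s \in Y -> (forall u, u \in U -> surv k (s :\ u) u Y) ->
  docc (fun S => s \in S) (docc_seq (enum U) (fun u => surv k (s :\ u) u)) Y || bad J s Y.
Proof.
move=> cY kJ Us sY sv; case: (boolP (bad J s Y)) => [|nb]; first by rewrite orbT.
rewrite orbF; apply/existsP; exists [set s]; rewrite sub1set sY set11 /=.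
apply: (docc_seqI _ _ (fun u => reach k (s :\ u) u Y)); rewrite ?enum_uniq // => u.
(* The witness [[set s]] must be disjoint from the explorations: a walk from the root never returns
   to [s]. *)
- rewrite mem_enum => uU; rewrite subsetD1 reach_sub /=; apply/negP => er.
  have kJ' : (k < J)%N by apply: leq_ltn_trans kJ; rewrite -addnn leq_addl.
  have [H [m [_ [_ _ /eqP]]]] := walk_from_root k J s Y u s cY sY nb kJ' (subsetP Us _ uU) er.
  by [].
- by rewrite mem_enum => uU; apply: surv_reach (sv _ uU).
- move=> u'; rewrite !mem_enum => uU uU'; apply: reach_disjoint cY sY nb kJ _ _; exact: (subsetP Us).
Qed.

(** * Probability bounds for bad configurations and survival *)

Lemma bin_le_exp (n m : nat) : ('C(n, m) <= n ^ m)%N.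
Proof.
apply: leq_trans (_ : n ^_ m <= _)%N.
  by rewrite -bin_ffact leq_pmulr ?fact_gt0.
elim: m => [|m IH]; first by rewrite ffactn0.
by rewrite ffactnSr expnSr leq_mul // leq_subr.
Qed.

(** Union bound over [j], over at most [#|V| ^ j] sets [X], and over families [F] of [j.+2] subsets
    of [s :|: X], crudely counted among all families of such subsets. *)
Lemma pr_bad {R : realFieldType} {V : finType} (p : R) (D : {set {set V}}) (J : nat)
    (s : {set V}) : 0 <= p <= 1 ->
  pr p D (bad J s) <=
  \sum_(j < J) (2 ^ 2 ^ (#|s| + j))%:R * #|V|%:R ^+ j * p ^+ j.+2.
Proof.
move=> hp; have [p0 p1] := andP hp.
apply: le_trans (pr_union_bound p D xpredT (fun (j : 'I_J) Y => [exists X : {set V},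
     (#|X| == j :> nat) && (j.+2 <= #|spanned Y (s :|: X)|)%N]) _ hp _) _.
  by move=> Y _ /existsP[j h]; exists j.
apply: ler_sum => j _.
apply: le_trans (pr_union_bound p D (fun X : {set V} => #|X| == j)
  (fun X Y => (j.+2 <= #|spanned Y (s :|: X)|)%N) _ hp _) _.
  by move=> Y _ /existsP[X /andP[h1 h2]]; exists X.
apply: (@le_trans _ _ (\sum_(X : {set V} | #|X| == j) ((2 ^ 2 ^ (#|s| + j))%:R * p ^+ j.+2))).
  apply: ler_sum => X /eqP cX.
  apply: le_trans (pr_union_bound p D
    (fun F : {set {set V}} => (F \in powerset (powerset (s :|: X))) && (#|F| == j.+2))
    (fun F Y => F \subset Y) _ hp _) _.
    move=> Y _ big.
    have : (0 < #|[set F : {set {set V}} | F \subset spanned Y (s :|: X) & #|F| == j.+2]|)%N.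
      by rewrite cards_draws bin_gt0.
    case/card_gt0P => F; rewrite inE => /andP[FY cF]; exists F; last first.
      by apply: subset_trans FY _; apply/subsetP => f; rewrite inE => /andP[].
    rewrite cF andbT powersetE; apply/subsetP => f /(subsetP FY).
    by rewrite powersetE inE => /andP[].
  apply: (@le_trans _ _ (\sum_(F in powerset (powerset (s :|: X))) p ^+ j.+2)).
    rewrite big_mkcondr; apply: ler_sum => F _; case: eqP => [<-|_].
      exact: pr_superset.
    exact: exprn_ge0.
  rewrite sumr_const !card_powerset -[leLHS]mulr_natl ler_wpM2r ?exprn_ge0 // ler_nat.
  by rewrite !leq_exp2l // cardsU cX leq_subr.
rewrite sumr_const -[leLHS]mulr_natr mulrAC; apply: ler_wpM2r; first exact: exprn_ge0.
rewrite ler_wpM2l // -natrX ler_nat.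
by rewrite -cardsE card_draws bin_le_exp.
Qed.

(** Outside the bad event the van den Berg-Kesten inequality applies. The set [U] stays general: it
    omits one vertex of [s] in the recursion and is all of [s] in the final count. *)
Lemma pr_cluster {R : realFieldType} {V : finType} (p a b : R) (D : {set {set V}})
    (k : nat) (s U : {set V}) :
  (forall e, e \in D -> #|e| = #|s|) -> 0 <= p -> p <= 2^-1 -> U \subset s ->
  (forall u, u \in U -> pr p D (surv k (s :\ u) u) <= a) ->
  pr p D (bad k.*2.+1 s) <= b ->
  pr p D (fun Y => (s \in Y) && [forall (u | u \in U), surv k (s :\ u) u Y]) <=
    p * a ^+ #|U| + b.
Proof.
move=> cD p0 p2 Us sa sb; have hp : 0 <= p <= 1 by rewrite p0 /=; lra.
set A := docc (fun S : {set {set V}} => s \in S) (docc_seq (enum U) (fun u => surv k (s :\ u) u)).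
apply: (@le_trans _ _ (pr p D (predU A (bad k.*2.+1 s)))).
  apply: pr_mono => // Y YD /andP[sY /forall_inP sv]; apply: surv_docc => //.
  by move=> e /(subsetP YD); apply: cD.
have := prU p D A (bad k.*2.+1 s); have := pr_ge0 p D (predI A (bad k.*2.+1 s)) hp.
suff : pr p D A <= p * a ^+ #|U| by lra.
apply: le_trans (bk p D _ _ p0 p2 _ _) _.
- by move=> S S' /subsetP; apply.
- exact: docc_seq_increasing.
apply: ler_pM; rewrite ?pr_ge0 //.
  have := pr_superset p D [set s] hp; rewrite cards1 expr1; apply: le_trans.
  by apply: pr_mono => // S _; rewrite sub1set.
apply: le_trans (bk_seq p D _ _ p0 p2 _) _; first by move=> u; apply: surv_increasing.
rewrite big_enum -prodr_const; apply: ler_prod => u uU.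
by rewrite pr_ge0 // sa.
Qed.

Lemma pr_survS {R : realFieldType} {V : finType} (p a b : R) (D : {set {set V}})
    (d k : nat) :
  (forall e, e \in D -> #|e| = d.+1) -> 0 <= p -> p <= 2^-1 -> p * a ^+ d + b <= 1 ->
  0 <= a -> 0 <= b ->
  (forall (t : {set V}) w, #|t| = d -> w \notin t -> pr p D (surv k t w) <= a) ->
  (forall s : {set V}, #|s| = d.+1 -> pr p D (bad k.*2.+1 s) <= b) ->
  forall (t : {set V}) w, #|t| = d -> w \notin t ->
  pr p D (surv k.+1 t w) <= 1 - (1 - (p * a ^+ d + b)) ^+ #|V|.
Proof.
move=> cD p0 p2 q1 a0 b0 sa sb t w ct wt; have hp : 0 <= p <= 1 by rewrite p0 /=; lra.
pose A (v : V) (Y : {set {set V}}) :=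
  (v |: t \in Y) && [forall (u | u \in t), surv k ((v |: t) :\ u) u Y].
pose r := enum [pred v | (v \notin t) && (v != w)].
have iA v : increasing (A v).
  move=> Y Z YZ /andP[vY /forall_inP sv]; rewrite /A (subsetP YZ) //=.
  by apply/forall_inP => u ut; apply: surv_increasing YZ (sv _ ut).
apply: (@le_trans _ _ (pr p D (fun Y => has (fun v => A v Y) r))).
  apply: pr_mono => // Y _ /existsP[v /and4P[vt vw vY sv]]; apply/hasP; exists v.
    by rewrite mem_enum inE vt.
  by rewrite /A vY.
rewrite lerBrDl -lerBrDr; apply: le_trans (harris_seq p D r A hp iA).
set q := p * a ^+ d + b in q1 *.
have q0 : 0 <= q by rewrite addr_ge0 // mulr_ge0 // exprn_ge0.
have lq : 0 <= 1 - q by rewrite subr_ge0.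
(* At most [#|V|] vertices are available, and further factors [1 - q <= 1] only lower the
   product. *)
apply: (@le_trans _ _ ((1 - q) ^+ size r)).
  apply: ler_wiXn2l => //; first by rewrite gerBl.
  by rewrite -cardE max_card.
rewrite /r -cardE -prodr_const big_enum; apply: ler_prod => v; rewrite inE => /andP[vt vw].
rewrite lq lerD2l lerN2 /=.
have cs : #|v |: t| = d.+1 by rewrite cardsU1 vt ct.
rewrite /q -ct; apply: pr_cluster => //.
- by move=> e /cD ->.
- exact: subsetUr.
- move=> u ut; apply: sa; last by rewrite !inE eqxx.
  by move: cs; rewrite (cardsD1 u) !inE ut orbT => -[].
- exact: sb.
Qed.

(** * From collapses to survival *)

Lemma R_iter_sub (n d i : nat) (S : {set {set 'I_n}}) : R_iter d i S \subset S.
Proof.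
elim: i => [|i IH]; first exact: subxx.
by apply: subset_trans IH; apply/subsetP => s; rewrite inE => /andP[].
Qed.

Lemma R_iter_stable (n d i : nat) (S : {set {set 'I_n}}) :
  (#|R_iter d i S| + i <= #|S|)%N \/ collapse_step d (R_iter d i S) = R_iter d i S.
Proof.
elim: i => [|i [IH|IH]]; [by left; rewrite addn0| |by right; rewrite /= !IH].
have sub : collapse_step d (R_iter d i S) \subset R_iter d i S.
  by apply/subsetP => s; rewrite inE => /andP[].
have [E|E] := eqVneq (collapse_step d (R_iter d i S)) (R_iter d i S).
  by right; rewrite /= !E.
left; apply: leq_trans IH; rewrite addnS -addSn leq_add2r.
by apply: proper_card; rewrite properEneq E sub.
Qed.

(** After [#|S|] steps either a fixed point has been met or nothing is left. Earlier iterates are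
    larger, later ones are equal. *)
Lemma R_infty_sub (n d k : nat) (S : {set {set 'I_n}}) :
  R_infty d S \subset R_iter d k S.
Proof.
have fixS : collapse_step d (R_infty d S) = R_infty d S.
  case: (R_iter_stable n d #|S| S) => // le0.
  have -> : R_infty d S = set0.
    by apply/eqP; rewrite -cards_eq0 -leqn0 -(leq_add2r #|S|).
  by apply/setP => s; rewrite !inE.
have [kS|kS] := leqP k #|S|.
  rewrite /R_infty -(subnK kS) /R_iter iterD.
  exact: (R_iter_sub n d (#|S| - k) (R_iter d k S)).
suff -> : R_iter d k S = R_infty d S by exact: subxx.
rewrite -(subnK (ltnW kS)) /R_iter iterD -/(R_iter d #|S| S) -/(R_infty d S).
by elim: (k - #|S|)%N => [//|m IH] /=; rewrite IH.
Qed.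

(** If [w |: t] outlives one more step, [t] is not free, so a second simplex [v |: t] of the
    previous iterate contains it; induction applies to the other facets of [v |: t]. *)
Lemma R_iter_surv (n d k : nat) (t : {set 'I_n}) (w : 'I_n) (Y : {set {set 'I_n}}) :
  (forall e, e \in Y -> #|e| = d.+1) -> #|t| = d -> w \notin t ->
  w |: t \in R_iter d k Y -> surv k t w Y.
Proof.
move=> cY; elim: k t w => [//|k IH] t w ct wt.
rewrite /= inE => /andP[wR /existsPn/(_ t)]; rewrite subsetUr andbT /free_face ct eqxx /= => n1.
set F := [set s in R_iter d k Y | t \subset s] in n1.
have wF : w |: t \in F by rewrite inE wR subsetUr.
have : (0 < #|F :\ (w |: t)|)%N.
  by rewrite lt0n; apply: contra n1 => /eqP c0; rewrite (cardsD1 (w |: t)) wF c0.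
case/card_gt0P => s; rewrite !inE => /and3P[sw sR ts].
have sY : s \in Y by apply: subsetP sR; apply: R_iter_sub.
have : (0 < #|s :\: t|)%N by rewrite cardsD (setIidPr ts) cY // ct subSnn.
case/card_gt0P => v; rewrite inE => /andP[vt vs].
have sE : s = v |: t.
  apply/esym/eqP; rewrite eqEcard subUset sub1set vs ts /= cardsU1 vt ct cY //.
apply/existsP; exists v; rewrite vt -sE sY /=; apply/andP; split.
  by apply: contraNneq sw => <-; apply/eqP.
apply/forall_inP => u ut; have us : u \in s by apply: (subsetP ts).
apply: IH; last by rewrite setD1K.
  by have := cY _ sY; rewrite (cardsD1 u) us => -[].
by rewrite !inE eqxx.
Qed.

Lemma R_infty_surv (n d k : nat) (s : {set 'I_n}) (Y : {set {set 'I_n}}) :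
  (forall e, e \in Y -> #|e| = d.+1) -> s \in R_infty d Y ->
  (s \in Y) && [forall (u | u \in s), surv k (s :\ u) u Y].
Proof.
move=> cY sR; have sY : s \in Y by apply: subsetP sR; apply: R_iter_sub.
rewrite sY /=; apply/forall_inP => u us; apply: (R_iter_surv n d) => //.
- by have := cY _ sY; rewrite (cardsD1 u) us => -[].
- by rewrite !inE eqxx.
- by rewrite setD1K //; apply: subsetP sR; apply: R_infty_sub.
Qed.

Lemma card_dsimplices_le (n d : nat) : (#|dsimplices n d| <= n ^ d.+1)%N.
Proof. by rewrite card_draws card_ord bin_le_exp. Qed.

(** * Asymptotics *)

From mathcomp Require Import all_classical all_reals all_analysis.
Import Order.TTheory GRing.Theory Num.Theory.
Import numFieldNormedType.Exports.
Local Open Scope ring_scope.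
Local Open Scope classical_set_scope.

(** Probability that a facet survives [k] rounds in the limiting branching tree, where each facet
    has a Poisson number of mean [g] of further simplices, each bringing [d] new facets. *)
Fixpoint limit_surv {R : realType} (d : nat) (g : R) (k : nat) : R :=
  if k is k'.+1 then 1 - expR (- (g * limit_surv d g k' ^+ d)) else 1.

Lemma limit_surv_gt0 {R : realType} (d : nat) (g : R) (k : nat) :
  0 < g -> 0 < limit_surv d g k.
Proof.
move=> g0; elim: k => [|k IH] //=.
by rewrite subr_gt0 expR_lt1 oppr_lt0 mulr_gt0 // exprn_gt0.
Qed.

Lemma limit_surv_le1 {R : realType} (d : nat) (g : R) (k : nat) : limit_surv d g k <= 1.
Proof. by case: k => [|k] //=; rewrite gerBl expR_ge0. Qed.

Lemma limit_surv_decr {R : realType} (d : nat) (g : R) (k : nat) :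
  0 < g -> limit_surv d g k.+1 <= limit_surv d g k.
Proof.
move=> g0; elim: k => [|k IH]; first exact: limit_surv_le1.
rewrite [leLHS]/= [leRHS]/= lerD2l lerN2 ler_expR lerN2.
apply: ler_wpM2l; first exact: ltW.
have u0 j : limit_surv d g j \is Num.nneg by rewrite nnegrE ltW // limit_surv_gt0.
exact: (lerXn2r d (u0 k.+1) (u0 k)).
Qed.

Lemma limit_surv_cvg0 {R : realType} (d : nat) (g : R) :
  0 < g -> g < gamma_d R d -> limit_surv d g @ \oo --> (0 : R).
Proof.
move=> g0 gG; set u := limit_surv d g.
have ucvg : cvgn u.
  apply: nonincreasing_is_cvgn.
    by apply/nonincreasing_seqP => k; apply: limit_surv_decr.
  by exists 0 => _ [k _ <-]; apply/ltW/limit_surv_gt0.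
set L := limn u.
have uS : [sequence u k.+1]_k @ \oo --> L by rewrite cvg_shiftS.
have uS' : [sequence u k.+1]_k @ \oo --> 1 - expR (- (g * L ^+ d)).
  apply: cvgB; first exact: cvg_cst.
  apply: (@continuous_cvg _ _ _ _ _ _ (@expR R)); first exact: continuous_expR.
  apply: cvgN; apply: cvgM; first exact: cvg_cst.
  by apply: (@continuous_cvg _ _ _ _ _ _ (fun x : R => x ^+ d)) => //; apply: exprn_continuous.
have LE : L = 1 - expR (- (g * L ^+ d)).
  exact: (cvg_unique (@norm_hausdorff _ _) uS uS').
have L0 : 0 <= L by apply: limr_ge => //; near=> k; apply/ltW/limit_surv_gt0.
have [L00|Ln0] := eqVneq L 0; first by rewrite -L00.
have Lpos : 0 < L by rewrite lt_def Ln0.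
(* For [L > 0] the number [1 - L] is a solution below 1 for the parameter [g], so [g] belongs to the
   set whose infimum is [gamma_d R d]. *)
suff : gamma_d R d <= g by rewrite leNgt gG.
apply: ge_inf; first by exists 0 => x [].
split; first exact: ltW.
exists (1 - L); split; first by rewrite gtrBl.
by rewrite opprB addrC subrK [in RHS]LE opprB addrC subrK.
Unshelve. all: by end_near. Qed.

(** * Comparison with the limit recursion for large [n] *)

Lemma expR_le_pow {R : realType} (q M : R) (n : nat) :
  0 <= q -> q < 1 -> n%:R * q <= M * (1 - q) -> expR (- M) <= (1 - q) ^+ n.
Proof.
move=> q0 q1 nq; have q1' : 0 < 1 - q by rewrite subr_gt0.
(* After inversion this is [1 + x <= expR x] at [x = q / (1 - q)], where [1 + x] is the inverse of
   [1 - q]. *)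
have h : expR (- (q / (1 - q))) <= 1 - q.
  rewrite expRN -[leRHS]invrK lef_pV2 ?posrE ?invr_gt0 ?expR_gt0 //.
  apply: le_trans (expR_ge1Dx _).
  by rewrite -[X in _ <= X + _](divff (lt0r_neq0 q1')) -mulrDl subrK mul1r.
apply: (@le_trans _ _ (expR (- (q / (1 - q))) ^+ n)); last first.
  by rewrite lerXn2r // nnegrE ?expR_ge0 // ltW.
rewrite -expRM_natl ler_expR mulrN lerN2 mulrA ler_pdivrMr //.
Qed.

(** The bound of [pr_bad] at [p = c/n] and [#|s| = d.+1], with the common factor [1/n^2] taken
    out. *)
Definition bad_const {R : realType} (d : nat) (c : R) (J : nat) : R :=
  \sum_(j < J) (2 ^ 2 ^ (d.+1 + j))%:R * c ^+ j.+2.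

Lemma bad_const_ge0 {R : realType} (d : nat) (c : R) (J : nat) :
  0 <= c -> 0 <= bad_const d c J.
Proof. by move=> c0; apply: sumr_ge0 => j _; rewrite mulr_ge0 // exprn_ge0. Qed.

Lemma pr_bad_const {R : realType} (n d J : nat) (c : R) (D : {set {set 'I_n}})
    (s : {set 'I_n}) : (0 < n)%N -> 0 <= c / n%:R <= 1 -> #|s| = d.+1 ->
  pr (c / n%:R) D (bad J s) <= bad_const d c J / n%:R ^+ 2.
Proof.
move=> n0 hp cs; apply: le_trans (pr_bad _ D J s hp) _.
rewrite /bad_const big_distrl /= cs card_ord; apply: ler_sum => j _.
have n0' : n%:R != 0 :> R by rewrite pnatr_eq0 -lt0n.
rewrite le_eqVlt; apply/orP; left; apply/eqP.
have cancel (C x y z : R) : y != 0 -> z != 0 -> C * y * (x / (y * z)) = C * x / z.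
  by move=> y0 z0; field; rewrite y0 z0.
by rewrite expr_div_n -(cancel _ _ (n%:R ^+ j)) ?expf_neq0 // -exprD addn2.
Qed.

(** The gap between [c] and [g] absorbs both the [1/n^2] error and the passage from a power to an
    exponential. The threshold on [n] is uniform in [t] and [w], as the induction requires. *)
Lemma pr_surv_le {R : realType} (d k : nat) (c g : R) : 0 < c -> c < g ->
  \forall n \near \oo, forall (t : {set 'I_n}) w, #|t| = d -> w \notin t ->
    pr (c / n%:R) (dsimplices n d) (surv k t w) <= limit_surv d g k.
Proof.
move=> c0 cg; elim: k => [|k IH].
  near=> n => t w _ _ /=; apply: pr_le1.
  have n2 : 2 * c + 1 <= n%:R by near: n; exact: nbhs_infty_ger.
  have n0 : 0 < n%:R :> R by lra.
  apply/andP; split; first by rewrite divr_ge0 ?ltW.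
  by rewrite ler_pdivrMr //; lra.
have g0 : 0 < g by lra.
set a := limit_surv d g k in IH *.
have a0 : 0 < a by apply: limit_surv_gt0.
set K := bad_const d c k.*2.+1.
have K0 : 0 <= K by apply: bad_const_ge0; apply: ltW.
pose m := c * a ^+ d; pose M := g * a ^+ d.
have m0 : 0 < m by rewrite mulr_gt0 // exprn_gt0.
have mM : m < M by rewrite ltr_pM2r // exprn_gt0.
near=> n.
have IHn : forall (t : {set 'I_n}) w, #|t| = d -> w \notin t ->
    pr (c / n%:R) (dsimplices n d) (surv k t w) <= a by near: n.
have n2 : 2 * c + 1 <= n%:R by near: n; exact: nbhs_infty_ger.
have n3 : m + K + 1 <= n%:R by near: n; exact: nbhs_infty_ger.
(* This threshold gives [n * q <= M * (1 - q)]: multiplied by [n], with [n * q = m + K / n] and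
   [K / n <= K], the inequality follows from [K + M * m + M * K <= n * (M - m)]. *)
have n4 : (K + M * m + M * K) / (M - m) <= n%:R by near: n; exact: nbhs_infty_ger.
have n0 : 0 < n%:R :> R by lra.
have n1 : (0 < n)%N by rewrite -(ltr_nat R).
have n1' : 1 <= n%:R :> R by rewrite ler1n.
have p0 : 0 <= c / n%:R by rewrite divr_ge0 ?ltW.
have p2 : c / n%:R <= 2^-1 by rewrite ler_pdivrMr //; lra.
pose q := c / n%:R * a ^+ d + K / n%:R ^+ 2.
have b0 : 0 <= K / n%:R ^+ 2 by rewrite divr_ge0 // exprn_ge0.
have q0 : 0 <= q by rewrite addr_ge0 // mulr_ge0 // exprn_ge0 // ltW.
have nq : n%:R * q = m + K / n%:R by rewrite /q /m; field; rewrite gt_eqF.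
have Kn : K / n%:R <= K by rewrite ler_pdivrMr // ler_peMr.
have q1 : q < 1.
  rewrite -(ltr_pM2l n0) nq; lra.
move=> t w ct wt.
apply: le_trans (_ : _ <= 1 - (1 - q) ^+ #|'I_n|) _.
  apply: pr_survS => //; [|exact: ltW|exact: ltW|].
  - by move=> e; rewrite inE => /eqP.
  - move=> s cs; apply: pr_bad_const => //; rewrite p0 /=; lra.
rewrite lerD2l lerN2 card_ord; apply: expR_le_pow => //.
rewrite nq -/M -(ler_pM2l n0).
have e1 : n%:R * (m + K / n%:R) = n%:R * m + K by field; rewrite gt_eqF.
have e2 : n%:R * (M * (1 - q)) = n%:R * M - M * m - M * (K / n%:R).
  by rewrite mulrCA mulrBr mulr1 nq; ring.
have M0 : 0 <= M by lra.
have e3 := ler_wpM2l M0 Kn.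
have e4 : K + M * m + M * K <= n%:R * (M - m) by rewrite -ler_pdivrMr // subr_gt0.
rewrite e1 e2; lra.
Unshelve. all: by end_near. Qed.

(** Markov's inequality over at most [n ^ d.+1] simplices, each in the core with probability at most
    [c / n * a ^+ d.+1] plus the bad term, as all [d.+1] of its facets survive. *)
Lemma pr_core_le {R : realType} (n d k : nat) (c a delta : R) :
  (0 < n)%N -> 0 < delta -> 0 <= c -> 0 <= a -> c / n%:R <= 2^-1 ->
  (forall (t : {set 'I_n}) w, #|t| = d -> w \notin t ->
    pr (c / n%:R) (dsimplices n d) (surv k t w) <= a) ->
  prob_Yd d (c / n%:R) (fun S => delta * n%:R ^+ d < #|@R_infty n d S|%:R) <=
  (c * a ^+ d.+1 + bad_const d c k.*2.+1 / n%:R) / delta.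
Proof.
move=> n0 delta0 c0 a0 p2 sa; set p := c / n%:R in p2 sa *; set D := dsimplices n d in sa *.
have p0 : 0 <= p by rewrite divr_ge0.
have hp : 0 <= p <= 1 by rewrite p0 /=; lra.
have nR : 0 < n%:R :> R by rewrite ltr0n.
have cD e : e \in D -> #|e| = d.+1 by rewrite inE => /eqP.
set K := bad_const d c k.*2.+1.
have K0 : 0 <= K by apply: bad_const_ge0.
have da : 0 < delta * n%:R ^+ d by rewrite mulr_gt0 // exprn_gt0.
apply: le_trans (pr_markov p D (@R_infty n d) _ hp da _) _.
  by move=> S SD; apply: fintype.subset_trans SD; apply: R_iter_sub.
rewrite ler_pdivrMr //.
apply: (@le_trans _ _ (\sum_(s in D) (p * a ^+ d.+1 + K / n%:R ^+ 2))).
  apply: ler_sum => s /cD cs.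
  apply: le_trans (_ : _ <= pr p D (fun Y => (s \in Y) &&
    [forall (u | u \in s), surv k (s :\ u)%SET u Y])) _.
    apply: pr_mono => // Y YD sR.
    by apply: R_infty_surv sR => e /(fintype.subsetP YD) /cD.
  rewrite -cs; apply: pr_cluster => //.
  - by move=> e /cD ->.
  - move=> u us; apply: sa; last by rewrite !inE eqxx.
    by move: cs; rewrite (cardsD1 u) us => -[].
  - exact: pr_bad_const.
set b := c * a ^+ d.+1 + K / n%:R.
have b0 : 0 <= b by rewrite addr_ge0 ?divr_ge0 ?mulr_ge0 ?exprn_ge0 // ltW.
have -> : p * a ^+ d.+1 + K / n%:R ^+ 2 = b / n%:R by rewrite /p /b; field; rewrite lt0r_neq0.
have -> : b / delta * (delta * n%:R ^+ d) = b / n%:R * n%:R ^+ d.+1.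
  by rewrite [in RHS]exprS; field; rewrite !lt0r_neq0.
rewrite sumr_const -[leLHS]mulr_natr ler_wpM2l ?divr_ge0 ?(ltW nR) // -natrX ler_nat.
exact: card_dsimplices_le.
Qed.

Theorem theorem8 (R : realType) (d : nat) (delta c : R) :
  (2 <= d)%N -> 0 < delta -> 0 < c -> c < @gamma_d R d ->
  (fun n : nat =>
     @prob_Yd R n d (c / n%:R)
       (fun S => delta * n%:R ^+ d < (#|@R_infty n d S|)%:R)) @ \oo --> (0 : R).
Proof.
move=> _ delta0 c0 cG.
pose g := (c + gamma_d R d) / 2.
have cg : c < g by rewrite /g; lra.
have gG : g < gamma_d R d by rewrite /g; lra.
have g0 : 0 < g by lra.
apply/cvgrPdist_le => e e0.
(* The depth [k] is fixed before [n]: it takes care of half of [e * delta], and the bad term [K / n]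
   gets the other half through [n3]. *)
have [k uk] : exists k, c * limit_surv d g k <= e * delta / 2.
  have /cvgrPdist_le/(_ (e * delta / 2 / c)) := limit_surv_cvg0 d g g0 gG.
  rewrite divr_gt0 ?mulr_gt0 // => /(_ isT) [k _ /(_ k (leqnn k))].
  rewrite sub0r normrN gtr0_norm ?limit_surv_gt0 // => h.
  by exists k; rewrite mulrC -ler_pdivlMr.
set a := limit_surv d g k in uk.
have a0 : 0 < a by apply: limit_surv_gt0.
set K := bad_const d c k.*2.+1.
have K0 : 0 <= K by apply: bad_const_ge0; apply: ltW.
near=> n.
have sa : forall (t : {set 'I_n}) w, #|t| = d -> w \notin t ->
    pr (c / n%:R) (dsimplices n d) (surv k t w) <= a by near: n; exact: pr_surv_le.
have n2 : 2 * c + 1 <= n%:R by near: n; exact: nbhs_infty_ger.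
have n3 : 2 * K / (e * delta) <= n%:R by near: n; exact: nbhs_infty_ger.
have nR : 0 < n%:R :> R by lra.
have n0 : (0 < n)%N by rewrite -(ltr_nat R).
have p0 : 0 <= c / n%:R by rewrite divr_ge0 ?ltW.
have p2 : c / n%:R <= 2^-1 by rewrite ler_pdivrMr //; lra.
rewrite sub0r normrN ger0_norm; last by apply: pr_ge0; rewrite p0 /=; lra.
apply: le_trans (pr_core_le n d k c a delta n0 delta0 (ltW c0) (ltW a0) p2 sa) _.
have ed : 0 < e * delta by rewrite mulr_gt0.
(* As [a <= 1], the smallness of [c * a] secured by [uk] suffices. *)
have h1 : a ^+ d.+1 <= a.
  by rewrite exprS ler_piMr ?(ltW a0) // exprn_ile1 ?(ltW a0) // limit_surv_le1.
have h2 := ler_wpM2l (ltW c0) h1.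
have h3 : K / n%:R <= e * delta / 2.
  by rewrite ler_pdivrMr //; move: n3; rewrite ler_pdivrMr //; lra.
rewrite ler_pdivrMr //; rewrite -/K; lra.
Unshelve. all: by end_near. Qed.
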